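(* For every odd integer $r\ge 3$ we have $p_1(r)<p_2(r)$, where $$p_1(r)=\liminf_{k\to\infty}\frac{\log b_r(k)}{\log k},\qquad p_2(r)=\limsup_{k\to\infty}\frac{\log b_r(k)}{\log k},$$ and $b_r$ is the Euler binary partition function.
   Context: For $r\in\mathbb N$, the Euler binary partition function $b_r(k)$ is, for a nonnegative integer $k$, the total number of different binary expansions $k=\sum_{j=0}^{\infty}d_j2^j$ where the digits $d_j$ take values in $\{d\in\mathbb Z: 0\le d<r\}$ (all but finitely many digits being zero). *)

(* Defs.v *)
From HB Require Import structures.
From mathcomp Require Import all_boot all_order all_algebra finmap.
From mathcomp Require Import all_classical all_reals all_analysis.

Set Implicit Arguments.
Unset Strict Implicit.
Unset Printing Implicit Defensive.

Import Order.TTheory GRing.Theory Num.Theory.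

Local Open Scope classical_set_scope.

Definition binary_expansions (r k : nat) : set {fsfun nat -> nat with 0%N} :=
  [set d : {fsfun nat -> nat with 0%N} |
    (forall j : nat, d j < r)%N /\
    (\sum_(j <- finsupp d) d j * 2 ^ j)%N = k].

Lemma binary_expansions_bound r k (d : {fsfun nat -> nat with 0%N}) j :
  binary_expansions r k d -> (d j * 2 ^ j <= k)%N.
Proof.
case=> _ <-; case: (finsuppP d j) => [_|jd]; first by rewrite mul0n.
by rewrite (big_fsetD1 j) //= leq_addr.
Qed.

(* [fset_set] sends an infinite set to the empty one; this lemma shows that
   the default is never used in [euler_binary_partition]. *)
Lemma finite_binary_expansions r k : finite_set (binary_expansions r k).
Proof.
pose S := [fset nat_of_ord i | i in 'I_k.+1]%fset.
pose g (f : {ffun 'I_k.+1 -> 'I_k.+1}) : {fsfun nat -> nat with 0%N} :=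
  [fsfun j in S => nat_of_ord (f (inord j)) | 0%N].
have gfin : finite_set (g @` [set: {ffun 'I_k.+1 -> 'I_k.+1}]).
  exact/finite_image/finite_finset.
apply: sub_finite_set gfin => d dA; exists [ffun i => inord (d (nat_of_ord i))] => //.
apply/fsfunP => j; rewrite /g fsfunE.
have dj := binary_expansions_bound j dA.
have [jS|jS] := ifPn.
  have jk : (j < k.+1)%N by case/imfsetP: jS => i _ ->.
  rewrite ffunE inordK // (inordK jk) // ltnS (leq_trans _ dj) //.
  by rewrite leq_pmulr // expn_gt0.
have kj : (k < j)%N.
  rewrite ltnNge; apply: contra jS => jk; apply/imfsetP.
  by exists (inord j) => //=; rewrite inordK.
apply/esym/eqP; rewrite -leqn0 leqNgt; apply/negP => d0.
have := leq_ltn_trans dj kj; rewrite ltnNge; case/negP.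
by apply: (leq_trans (ltnW (ltn_expl j (ltnSn 1)))); rewrite leq_pmull.
Qed.

Definition euler_binary_partition (r k : nat) : nat :=
  #|` fset_set (binary_expansions r k)|%fset.

Section growth_exponents.
Context {R : realType}.
Local Open Scope ring_scope.

(* [ln 0 = 0] and division by [0] gives [0], so the values at [k = 0] and
   [k = 1] are junk; they do not affect the limits. *)
Definition log_ratio (r k : nat) : R :=
  ln (euler_binary_partition r k)%:R / ln k%:R.

Definition p1 (r : nat) : \bar R := limn_einf (fun k => (log_ratio r k)%:E).

Definition p2 (r : nat) : \bar R := limn_esup (fun k => (log_ratio r k)%:E).

End growth_exponents.

Arguments p1 : clear implicits.
Arguments p2 : clear implicits.

(* Main.v *)
Require Import Defs.
From mathcomp Require Import all_boot all_order all_algebra.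
From mathcomp Require Import all_classical all_reals all_analysis.
From mathcomp Require Import finmap zify ring lra.

(** Put [A i j = 1] if [i <= 2j < i + r] and [0] otherwise, for [i, j < r - 1].
    Removing the lowest digit gives [b_r(2K - i) = sum_j A i j * b_r(K - j)], so
    [b_r(2^n r - i)] is a coordinate of [A^n w] for a positive vector [w].
    Since [b_r] has mean about [(r/2)^n] at height [2^n], the number
    [log_2 (r/2)] separates [p_1] from [p_2]. It remains to see that [A^n w]
    does not grow like [(r/2)^n]. For odd [r], [det (r - 2A)] is odd, so
    [1 - (2/r) A] is invertible, and for a nonnegative matrix [M] with [1 - M]
    invertible, [M^n w] either decays geometrically or grows geometrically in
    some coordinate. The first case lowers [p_1], the second one raises [p_2]. *)

Set Implicit Arguments.
Unset Strict Implicit.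
Unset Printing Implicit Defensive.

Import Order.TTheory GRing.Theory Num.Theory.

Local Notation digits := {fsfun nat -> nat with 0%N}.
Implicit Types d e : digits.

(** * Binary expansions: prepending and removing the lowest digit *)

Definition digit_cons (a : nat) d : digits :=
  [fsfun j in (0%N |` [fset i.+1 | i in finsupp d])%fset =>
     if j is i.+1 then d i else a | 0%N].

Definition digit_tail d : digits :=
  [fsfun j in [fset i.-1 | i in finsupp d]%fset => d j.+1 | 0%N].

Lemma digit_cons0 a d : digit_cons a d 0%N = a.
Proof. by rewrite fsfunE !inE. Qed.

Lemma digit_consS a d j : digit_cons a d j.+1 = d j.
Proof.
rewrite fsfunE; case: ifPn => // jS; case: (finsuppP d j) => // jd.
by case/negP: jS; rewrite !inE /=; apply/imfsetP; exists j.
Qed.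

Lemma digit_tailE d j : digit_tail d j = d j.+1.
Proof.
rewrite fsfunE; case: ifPn => // jS; case: (finsuppP d j.+1) => // jd.
by case/negP: jS; apply/imfsetP; exists j.+1.
Qed.

Lemma digit_cons_tail d : digit_cons (d 0%N) (digit_tail d) = d.
Proof.
apply/fsfunP => -[|j]; first exact: digit_cons0.
by rewrite digit_consS digit_tailE.
Qed.

Lemma digit_cons_inj a b d e :
  digit_cons a d = digit_cons b e -> a = b /\ d = e.
Proof.
move=> /fsfunP E; split; first by move: (E 0%N); rewrite !digit_cons0.
by apply/fsfunP => j; move: (E j.+1); rewrite !digit_consS.
Qed.

Definition digit_value d : nat :=
  (\sum_(j <- finsupp d) d j * 2 ^ j)%N.

(** Replaces the support of [d], which changes irregularly under a shift of digits, by an initial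
    segment that can be reindexed. *)
Lemma digit_valueE n d :
  (forall j, n <= j -> d j = 0)%N -> digit_value d = (\sum_(j < n) d j * 2 ^ j)%N.
Proof.
move=> dn; rewrite -(big_mkord xpredT (fun j => d j * 2 ^ j)%N) /digit_value.
rewrite [RHS](bigID (fun j => j \in finsupp d)) /= [X in (_ + X)%N]big1 ?addn0; last first.
  by move=> j /fsfun_dflt ->.
rewrite -[RHS]big_filter; apply: perm_big; apply: uniq_perm.
- exact: fset_uniq.
- by rewrite filter_uniq // iota_uniq.
move=> j; rewrite mem_filter mem_index_iota /=.
case: (boolP (j \in finsupp d)) => //= jd; apply/esym; rewrite ltnNge.
by apply/negP => /dn; apply/eqP; move: jd; rewrite mem_finsupp.
Qed.

Lemma digit_support_bound d :
  exists n, forall j, (n <= j)%N -> d j = 0%N.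
Proof.
exists (\max_(j <- finsupp d) j).+1 => j jn; apply: fsfun_dflt.
by apply: contraL jn => jd; rewrite -ltnNge ltnS; exact: leq_bigmax_seq.
Qed.

Lemma digit_value_cons a d :
  digit_value (digit_cons a d) = (a + (digit_value d).*2)%N.
Proof.
have [n dn] := digit_support_bound d.
rewrite (digit_valueE dn) (@digit_valueE n.+1); last first.
  by case=> // j jn; rewrite digit_consS dn.
rewrite big_ord_recl digit_cons0 muln1 -muln2 big_distrl; congr addn.
by apply: eq_bigr => i _; rewrite /= digit_consS expnSr mulnA.
Qed.

Lemma card_fset_set_seq (T : choiceType) (A : set T) (s : seq T) :
  uniq s -> (forall x, x \in s <-> A x) -> #|` fset_set A|%fset = size s.
Proof.
move=> us sA; have -> : A = [set` [fset x in s]%fset]%classic.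
  by apply/seteqP; split => x /=; rewrite inE => /sA.
by rewrite set_fsetK card_fseq undup_id.
Qed.

(** * The recurrence for the partition function *)

Local Notation b := euler_binary_partition.

(* Here [l] is the value of the expansion with its lowest digit [k - 2 l] removed. *)
Lemma euler_binary_partition_rec r k :
  b r k = (\sum_(l < k.+1 | l.*2 <= k < l.*2 + r) b r l)%N.
Proof.
pose s := [seq digit_cons (k - l.*2) d |
  l <- [seq l <- iota 0 k.+1 | l.*2 <= k < l.*2 + r],
  d <- enum_fset (fset_set (binary_expansions r l))].
rewrite /b (@card_fset_set_seq _ _ s).
- rewrite size_allpairs_dep sumnE big_map big_filter.
  by rewrite -(big_mkord (fun l => l.*2 <= k < l.*2 + r) (b r)).
- apply: allpairs_uniq_dep.
  + by rewrite filter_uniq // iota_uniq.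
  + by move=> l _; exact: fset_uniq.
  move=> [l d] [l' d'] /allpairsPdep[x [y [xs _ ->]]] /allpairsPdep[x' [y' [xs' _ ->]]].
  (* Both doubles are at most [k], so the subtractions in [E] are not truncated and can be
     cancelled. *)
  move=> /digit_cons_inj[/= E ->]; have -> // : x = x'.
  by move: xs xs' E; rewrite !mem_filter; lia.
move=> d; split.
  move=> /allpairsPdep[l [e [+ + ->]]]; rewrite mem_filter.
  move=> /andP[/andP[lk kl] _].
  rewrite (_ : (e \in enum_fset _) = (e \in fset_set (binary_expansions r l))) //.
  rewrite in_fset_set; last exact: finite_binary_expansions.
  rewrite in_setE => -[er el]; split; first by case=> [|j]; rewrite ?digit_cons0 ?digit_consS //; lia.
  by have := digit_value_cons (k - l.*2) e; rewrite /digit_value el => ->; lia.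
move=> [dr dk]; apply/allpairsPdep; exists (digit_value (digit_tail d)), (digit_tail d).
have vE : k = (d 0%N + (digit_value (digit_tail d)).*2)%N.
  by rewrite -digit_value_cons digit_cons_tail.
have := dr 0%N => d0r.
split; last by rewrite (_ : (k - _)%N = d 0%N) ?digit_cons_tail //; lia.
  rewrite mem_filter mem_iota; move: vE d0r.
  by move: (d 0%N) (digit_value _) => a v; lia.
rewrite (_ : (_ \in enum_fset _) =
  (digit_tail d \in fset_set (binary_expansions r (digit_value (digit_tail d))))) //.
rewrite in_fset_set; last exact: finite_binary_expansions.
by rewrite in_setE; split=> // j; rewrite digit_tailE.
Qed.

(** With digits 0 and 1 available, [l = k./2] is always a term of the recurrence. *)
Lemma euler_binary_partition_gt0 r k : (2 <= r)%N -> (0 < b r k)%N.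
Proof.
move=> r2; elim/ltn_ind: k => -[_|k IH].
  rewrite /b cardfs_gt0; apply/fset0Pn; exists [fsfun].
  rewrite in_fset_set; last exact: finite_binary_expansions.
  rewrite in_setE; split=> [j|]; first by rewrite fsfunE; lia.
  by rewrite finsupp0 big_seq_fset0.
have hk : (k.+1./2 < k.+2)%N by lia.
rewrite euler_binary_partition_rec (bigD1 (Ordinal hk)) /=; last by lia.
by rewrite addn_gt0 IH //; lia.
Qed.

(** * Averages of the partition function at dyadic height *)

Lemma sum_ord_trunc (F : nat -> nat) m n : (m <= n)%N ->
  (forall i, m <= i -> F i = 0)%N -> (\sum_(i < n) F i = \sum_(i < m) F i)%N.
Proof.
move=> mn F0; rewrite (big_ord_widen n F mn) [RHS]big_mkcond; apply: eq_bigr => i _.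
by case: ltnP => // /F0.
Qed.

(** A summation range independent of [k], so that sums over [k] can be exchanged with it. *)
Lemma euler_binary_partition_rec_le r k n : (k < n.*2)%N ->
  b r k = (\sum_(l < n) (l.*2 <= k < l.*2 + r) * b r l)%N.
Proof.
move=> kn; rewrite euler_binary_partition_rec.
pose F l := ((l.*2 <= k < l.*2 + r) * b r l)%N.
have F0 l : (k < l.*2)%N -> F l = 0%N by move=> kl; rewrite /F leqNgt kl.
transitivity (\sum_(l < k.+1) F l)%N.
  by rewrite big_mkcond; apply: eq_bigr => l _; rewrite /F; case: ifP; rewrite ?mul1n.
have [nk|/ltnW kn'] := leqP n k.+1.
  by apply: sum_ord_trunc => // l nl; apply: F0; lia.
by apply/esym/sum_ord_trunc => // l kl; apply: F0; lia.
Qed.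

Lemma sum_ord_itv m a c :
  (\sum_(k < m) (a <= k < a + c) = minn (a + c) m - minn a m)%N.
Proof.
elim: m => [|m IH]; first by rewrite big_ord0; lia.
rewrite big_ord_recr /= IH; case: (boolP (a <= m < a + c)) => /=; lia.
Qed.

Lemma sum_euler_binary_partition r m n : (m <= n.*2)%N ->
  (\sum_(k < m) b r k =
   \sum_(l < n) (minn (l.*2 + r) m - minn l.*2 m) * b r l)%N.
Proof.
move=> mn; transitivity (\sum_(k < m) \sum_(l < n) (l.*2 <= k < l.*2 + r) * b r l)%N.
  by apply: eq_bigr => k _; apply: euler_binary_partition_rec_le; have := ltn_ord k; lia.
rewrite exchange_big; apply: eq_bigr => l _.
by rewrite -big_distrl sum_ord_itv.
Qed.

(** Each [l] feeds at most [r] indices [k], so doubling the range multiplies the sum by at most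
    [r]. *)
Lemma sum_euler_binary_partition_le r n :
  (\sum_(k < 2 ^ n) b r k <= r ^ n * b r 0)%N.
Proof.
elim: n => [|n IH]; first by rewrite big_ord1 mul1n.
rewrite (@sum_euler_binary_partition r _ (2 ^ n)); last by rewrite expnS mul2n.
rewrite (expnS r) -mulnA; apply: leq_trans (leq_mul (leqnn r) IH).
rewrite big_distrr; apply: leq_sum => l _; rewrite leq_mul2r; lia.
Qed.

(** The bounds [m_n = (r + 1) 2^n - r] solve [m_0 = 1], [m_(n+1) = 2 m_n + r]. Thus for [l < m_n]
    the whole window from [2 l] to [2 l + r - 1] lies below [m_(n+1)], and no term is lost. *)
Lemma sum_euler_binary_partition_ge r n :
  (r ^ n * b r 0 <= \sum_(k < r.+1 * 2 ^ n - r) b r k)%N.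
Proof.
elim: n => [|n IH].
  by rewrite muln1 (_ : (r.+1 - r = 1)%N) ?big_ord1 ?mul1n //; lia.
have [m mE] : exists m, (r.+1 * 2 ^ n - r)%N = m by eexists.
rewrite mE in IH.
have n0 : (0 < 2 ^ n)%N by rewrite expn_gt0.
have -> : (r.+1 * 2 ^ n.+1 - r = m.*2 + r)%N.
  rewrite -mE expnS mulnCA; have : (r <= r.+1 * 2 ^ n)%N by nia.
  by move: (r.+1 * 2 ^ n)%N => x; lia.
rewrite (@sum_euler_binary_partition r _ (m.*2 + r)); last by lia.
rewrite -(big_mkord xpredT
  (fun l => (minn (l.*2 + r) (m.*2 + r) - minn l.*2 (m.*2 + r)) * b r l)%N).
rewrite (@big_cat_nat _ _ _ m) //=; last by lia.
apply: leq_trans (leq_addr _ _); rewrite big_mkord.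
rewrite (expnS r) -mulnA; apply: leq_trans (leq_mul (leqnn r) IH) _.
rewrite big_distrr; apply: leq_sum => l _.
by rewrite leq_mul2r; have := ltn_ord l; lia.
Qed.

Lemma exists_le_average (F : nat -> nat) X m : (0 < m)%N ->
  (\sum_(i < m) F i <= X)%N -> exists2 i, (i < m)%N & (m * F i <= X)%N.
Proof.
move=> m0 FX; apply: contrapT => H.
have : (\sum_(i < m) X.+1 <= \sum_(i < m) m * F i)%N.
  by apply: leq_sum => i _; rewrite ltnNge; apply/negP => Fi; apply: H; exists i.
by rewrite -big_distrr sum_nat_const card_ord leq_pmul2l // ltnNge FX.
Qed.

Lemma exists_ge_average (F : nat -> nat) X m : (0 < m)%N ->
  (X <= \sum_(i < m) F i)%N -> exists2 i, (i < m)%N & (X <= m * F i)%N.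
Proof.
move=> m0 FX; apply: contrapT => H.
have : (\sum_(i < m) (1 + m * F i) <= \sum_(i < m) X)%N.
  by apply: leq_sum => i _; rewrite ltnNge; apply/negP => Fi; apply: H; exists i.
rewrite big_split -big_distrr !sum_nat_const card_ord /= -mulnDr leq_pmul2l //.
by rewrite add1n ltnNge FX.
Qed.

(** Averaging over the block from [2^n] to [2^(n+1) - 1] only is what forces [k] to be large. *)
Lemma exists_small_euler_binary_partition r n :
  exists k, (2 ^ n <= k)%N /\ (2 ^ n * b r k <= r ^ n.+1 * b r 0)%N.
Proof.
have := sum_euler_binary_partition_le r n.+1.
rewrite -(big_mkord xpredT (b r)) (@big_cat_nat _ _ _ (2 ^ n)) ?leq_exp2l //=.
move=> /(leq_trans (leq_addl _ _)); rewrite -{1}(add0n (2 ^ n)%N) big_addn big_mkord.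
have -> : (2 ^ n.+1 - 2 ^ n = 2 ^ n)%N by rewrite expnS; lia.
case/(exists_le_average (F := fun i => b r (i + 2 ^ n))); first by rewrite expn_gt0.
by move=> i _ H; exists (i + 2 ^ n)%N; split=> //; rewrite leq_addl.
Qed.

Lemma exists_large_euler_binary_partition r n :
  exists k, (k <= r.+1 * 2 ^ n)%N /\ (r ^ n * b r 0 <= r.+1 * 2 ^ n * b r k)%N.
Proof.
have [|k km H] := exists_ge_average _ (sum_euler_binary_partition_ge r n).
  have : (0 < 2 ^ n)%N by rewrite expn_gt0.
  nia.
exists k; split; first by lia.
by apply: leq_trans H _; rewrite leq_mul2r leq_subr orbT.
Qed.

(** In the recurrence put [l = n - j]. From [i <= r - 2] and [2 j < i + r] follows [j <= r - 2], so
    the window of [r - 1] offsets is mapped to itself. *)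
Lemma euler_binary_partition_sub r n i : (r <= n)%N -> (i < r.-1)%N ->
  b r (n.*2 - i) = (\sum_(j < r.-1) (i <= j.*2 < i + r) * b r (n - j))%N.
Proof.
move=> rn ir; rewrite (@euler_binary_partition_rec_le _ _ n.+1); last by lia.
rewrite (reindex_inj rev_ord_inj) /=.
transitivity (\sum_(j < n.+1) (i <= j.*2 < i + r) * b r (n - j))%N.
  apply: eq_bigr => j _; rewrite subSS; congr (nat_of_bool _ * _)%N.
  by have := ltn_ord j; lia.
apply: (@sum_ord_trunc (fun j => (i <= j.*2 < i + r) * b r (n - j))%N); first by lia.
by move=> j rj; rewrite (_ : (_ <= _ < _) = false) //; lia.
Qed.

(** * Growth or decay of the iterates of a nonnegative matrix *)

Section dichotomy.
Context {R : realType} (N : nat).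
Local Open Scope ring_scope.
Variables (M : 'M[R]_N) (w : 'cV[R]_N).
Hypothesis M_ge0 : forall i j, 0 <= M i j.
Hypothesis M_unit : 1%:M - M \in unitmx.
Hypothesis w_ge1 : forall i, 1 <= w i 0.

Let t n := iter n (mulmx M) w.
Let s n := \sum_(k < n) t k.
(** The formal sum of the Neumann series of the [M^k w], defined even if the series diverges. *)
Let v := invmx (1%:M - M) *m w.

Let mulmx_le (u u' : 'cV[R]_N) :
  (forall i, u i 0 <= u' i 0) -> forall i, (M *m u) i 0 <= (M *m u') i 0.
Proof. by move=> uu' i; rewrite !mxE; apply: ler_sum => j _; rewrite ler_wpM2l. Qed.

Let iter_le (u u' : 'cV[R]_N) n : (forall i, u i 0 <= u' i 0) ->
  forall i, iter n (mulmx M) u i 0 <= iter n (mulmx M) u' i 0.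
Proof. by move=> uu'; elim: n => //= n IH; exact: mulmx_le. Qed.

Let iterZ (c : R) (u : 'cV[R]_N) n :
  iter n (mulmx M) (c *: u) = c *: iter n (mulmx M) u.
Proof. by elim: n => //= n ->; rewrite scalemxAr. Qed.

Let v_fix : v = w + M *m v.
Proof.
have : (1%:M - M) *m v = w by rewrite /v mulmxA mulmxV // mul1mx.
by rewrite mulmxBl mul1mx => <-; rewrite subrK.
Qed.

Let v_expand n : v = s n + iter n (mulmx M) v.
Proof.
have iterD u u' m : iter m (mulmx M) (u + u') = iter m (mulmx M) u + iter m (mulmx M) u'.
  by elim: m => //= m ->; rewrite mulmxDr.
elim: n => [|n IH]; first by rewrite /s big_ord0 add0r.
rewrite {1}IH {1}v_fix iterD /s big_ord_recr /= -addrA; congr (_ + (_ + _)).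
by rewrite -iterSr.
Qed.

(* If [v >= w], then [M v = v - w] is at most a proper fraction of [v].
   Otherwise some partial sum of the Neumann series of [v] exceeds [v] in some
   coordinate [i]; since [s n + M^n v = v] and [v >= - C w], the excess
   [s n i - v i] is at most [C (s n.+1 i - s n i)], so it grows geometrically. *)
Lemma nonneg_iter_dichotomy :
  (exists i c rho, [/\ 0 < c, 1 < rho &
     exists n0, forall n, (n0 <= n)%N -> c * rho ^+ n <= iter n (mulmx M) w i 0]) \/
  (exists C rho, [/\ 0 < C, 0 < rho < 1 &
     forall n i, iter n (mulmx M) w i 0 <= C * rho ^+ n]).
Proof.
(* The sum bounds every coordinate of [v]; the 2 keeps [1 - C^-1] positive. *)
pose C : R := 2 + \sum_i `|v i 0|.
have vC i : `|v i 0| <= C.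
  rewrite /C (bigD1 i) //=.
  have : 0 <= \sum_(j | j != i) `|v j 0| by apply: sumr_ge0.
  lra.
have C2 : 2 <= C.
  have : 0 <= \sum_i `|v i 0| by apply: sumr_ge0.
  rewrite /C; lra.
have C0 : 0 < C by lra.
have sC n i : s n i 0 <= v i 0 + C * t n i 0.
  have -> : v i 0 = s n i 0 + iter n (mulmx M) v i 0 by rewrite {1}(v_expand n) mxE.
  have : iter n (mulmx M) (- C *: w) i 0 <= iter n (mulmx M) v i 0.
    apply: iter_le => j; rewrite mxE; have := vC j; have := w_ge1 j.
    rewrite ler_norml => w1 /andP[vj _]; nra.
  by rewrite iterZ mxE /t; lra.
have sS n i : s n.+1 i 0 = s n i 0 + t n i 0 by rewrite /s big_ord_recr mxE.
(* Since [s 1] is [w], this splits on whether [w <= v]. *)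
have [le_sv|] := pselect (forall i, s 1%N i 0 <= v i 0); last first.
  move=> /existsNP[i /negP]; rewrite -ltNge => sv; left.
  (* By [sC], [a n <= C * t n], while [a n.+1 = a n + t n]; hence this ratio. *)
  pose a n := s n i 0 - v i 0; pose rho := 1 + C^-1.
  have rho1 : 1 < rho by rewrite /rho ltrDl invr_gt0.
  have aS n : a n * rho <= a n.+1.
    have := sC n i; rewrite /a sS /rho mulrDr mulr1 => h.
    have : (s n i 0 - v i 0) / C <= t n i 0 by rewrite ler_pdivrMr //; lra.
    lra.
  have aG n : a 1%N * rho ^+ n <= a n.+1.
    elim: n => [|n IH]; first by rewrite expr0 mulr1.
    rewrite exprSr mulrA; apply: le_trans (aS n.+1).
    by rewrite ler_wpM2r //; lra.
  exists i, (a 1%N / (rho * C)), rho; split=> //.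
    by rewrite divr_gt0 ?mulr_gt0 //; rewrite /a; lra.
  exists 1%N => -[//|n] _.
  have E : a 1%N / (rho * C) * rho ^+ n.+1 = (a 1%N * rho ^+ n) / C.
    by rewrite exprS; field; rewrite !gt_eqF //; lra.
  rewrite E ler_pdivrMr //; apply: le_trans (aG n) _.
  by have := sC n.+1 i; rewrite /a /t; lra.
right; exists C, (1 - C^-1).
have Ci : 0 < C^-1 <= 2^-1 by rewrite invr_gt0 C0 lef_pV2 ?posrE.
split=> //; first by lra.
have wv i : w i 0 <= v i 0.
  by have := le_sv i; rewrite /s big_ord_recr /= big_ord0 add0r.
move=> n i; apply: le_trans (iter_le n wv i) _; elim: n i => [|n IH] i.
  by rewrite expr0 mulr1; apply: le_trans (vC i); rewrite ler_norm.
(* Coordinatewise, [M v = v - w] and [w >= 1 >= v / C]. *)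
have Mv j : (M *m v) j 0 <= ((1 - C^-1) *: v) j 0.
  rewrite [leRHS]mxE.
  have E : v j 0 = w j 0 + (M *m v) j 0 by rewrite {1}v_fix mxE.
  have : C^-1 * v j 0 <= 1.
    by rewrite mulrC ler_pdivrMr // mul1r (le_trans _ (vC j)) // ler_norm.
  by have := w_ge1 j; rewrite mulrBl mul1r; lra.
rewrite iterSr; apply: le_trans (iter_le n Mv i) _.
rewrite iterZ mxE exprS mulrCA ler_wpM2l //; lra.
Qed.

End dichotomy.

(** * From growth along powers of two to bounds on the exponents *)

Section growth.
Context {R : realType}.
Local Open Scope ring_scope.

Lemma ln2_gt0 : 0 < ln 2 :> R.
Proof. by rewrite ln_gt0 // ltr1n. Qed.

Lemma limn_einf_le (u : nat -> \bar R) (x : \bar R) :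
  (forall m, exists2 k, (m <= k)%N & (u k <= x)%E) -> (limn_einf u <= x)%E.
Proof.
move=> ux; rewrite limn_einf_lim; apply: lime_le; first exact: is_cvg_einfs.
near=> m; have [k mk ukx] := ux m; apply: le_trans ukx.
by apply: ereal_inf_lbound; exists k.
Unshelve. all: by end_near. Qed.

Lemma limn_esup_ge (u : nat -> \bar R) (x : \bar R) :
  (forall m, exists2 k, (m <= k)%N & (x <= u k)%E) -> (x <= limn_esup u)%E.
Proof.
move=> ux; rewrite limn_esup_lim; apply: lime_ge; first exact: is_cvg_esups.
near=> m; have [k mk ukx] := ux m; apply: le_trans ukx _.
by apply: ereal_sup_ubound; exists k.
Unshelve. all: by end_near. Qed.

Lemma p1_le r (C c rho : R) : (2 <= r)%N -> 0 < C -> 0 < c -> 1 <= rho ->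
  (forall n0, exists n k, [/\ (n0 <= n)%N, c * 2 ^+ n <= k%:R &
     (b r k)%:R <= C * rho ^+ n]) ->
  (p1 R r <= (ln rho / ln 2)%:E)%E.
Proof.
move=> r2 C0 c0 rho1 H; set x := ln rho / ln 2.
have l2 := ln2_gt0; have xE : ln rho = x * ln 2 by rewrite /x divfK ?gt_eqF.
apply/lee_addgt0Pr => e e0; apply: limn_einf_le => m.
(* For [n > B] the three terms let [e] absorb the constants, give [ln k >= 1], and give [k >= m]. *)
pose B : R := `|(ln C - (x + e) * ln c) / (e * ln 2)| + `|(1 - ln c) / ln 2| + `|m%:R / c|.
have [n [k [nB ck bk]]] := H (Num.truncn B).+1.
have Bn : B < n%:R.
  by apply: lt_le_trans (truncnS_gt B) _; rewrite ler_nat.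
have n2 : n%:R <= 2 ^+ n :> R by rewrite -natrX ler_nat ltnW // ltn_expl.
have B1 := ler_norm ((ln C - (x + e) * ln c) / (e * ln 2)).
have B2 := ler_norm ((1 - ln c) / ln 2).
have B3 := ler_norm (m%:R / c).
have B1' := normr_ge0 ((ln C - (x + e) * ln c) / (e * ln 2)).
have B2' := normr_ge0 ((1 - ln c) / ln 2).
have B3' := normr_ge0 (m%:R / c).
have {B1} h1 : ln C - (x + e) * ln c <= n%:R * (e * ln 2).
  by rewrite -ler_pdivrMr ?mulr_gt0 //; move: Bn; rewrite /B; lra.
have {B2} h2 : 1 - ln c <= n%:R * ln 2.
  by rewrite -ler_pdivrMr //; move: Bn; rewrite /B; lra.
have {B3} h3 : m%:R <= n%:R * c.
  by rewrite -ler_pdivrMr //; move: Bn; rewrite /B; lra.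
have k0 : 0 < k%:R :> R by apply: lt_le_trans ck; rewrite mulr_gt0 ?exprn_gt0.
exists k; first by rewrite -(ler_nat R); nra.
have lk : ln c + n%:R * ln 2 <= ln k%:R.
  rewrite mulr_natl -lnXn // -lnM ?posrE ?exprn_gt0 // ler_ln ?posrE //.
  by rewrite mulr_gt0 ?exprn_gt0.
have b0 : 0 < (b r k)%:R :> R by rewrite ltr0n euler_binary_partition_gt0.
have rho0 : 0 < rho by lra.
have lb : ln (b r k)%:R <= ln C + n%:R * ln rho.
  rewrite mulr_natl -lnXn // -lnM ?posrE ?exprn_gt0 // ler_ln ?posrE //.
  by rewrite mulr_gt0 ?exprn_gt0.
have x0 : 0 <= x by apply: divr_ge0; [exact: ln_ge0 | exact: ltW].
rewrite -EFinD lee_fin /log_ratio ler_pdivrMr; last by lra.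
move: lb; rewrite xE; nra.
Qed.

Lemma le_p2 r (C c rho : R) : (2 <= r)%N -> 0 < C -> 0 < c -> 1 < rho ->
  (forall n0, exists n k, [/\ (n0 <= n)%N, k%:R <= C * 2 ^+ n &
     c * rho ^+ n <= (b r k)%:R]) ->
  ((ln rho / ln 2)%:E <= p2 R r)%E.
Proof.
move=> r2 C0 c0 rho1 H; set x := ln rho / ln 2.
have l2 := ln2_gt0; have xE : ln rho = x * ln 2 by rewrite /x divfK ?gt_eqF.
have lr : 0 < ln rho by exact: ln_gt0.
have x0 : 0 < x by rewrite /x divr_gt0.
(* Nonnegativity of [y] lets the upper bound on [ln k] be multiplied by it; the gap [x - y] absorbs
   the constants. *)
suff Hx y : 0 <= y < x -> (y%:E <= p2 R r)%E.
  apply/lee_subgt0Pr => e e0; have [ex|xe] := ltP e x.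
    by rewrite -EFinB; apply: Hx; lra.
  by apply: le_trans (Hx 0 _); rewrite -?EFinB ?lee_fin; lra.
move=> /andP[y0 yx]; apply: limn_esup_ge => m.
pose K := (maxn m 2).
(* No lower bound on [k] is given: a value of at least [D + 1] cannot occur below [K]. *)
pose D : R := \sum_(k < K) (b r k)%:R.
have D0 : 0 <= D by apply: sumr_ge0.
pose B : R := `|(y * ln C - ln c) / ((x - y) * ln 2)| + `|(ln (D + 1) - ln c) / ln rho|.
have [n [k [nB ck bk]]] := H (Num.truncn B).+1.
have Bn : B < n%:R.
  by apply: lt_le_trans (truncnS_gt B) _; rewrite ler_nat.
have B1 := ler_norm ((y * ln C - ln c) / ((x - y) * ln 2)).
have B2 := ler_norm ((ln (D + 1) - ln c) / ln rho).
have B1' := normr_ge0 ((y * ln C - ln c) / ((x - y) * ln 2)).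
have B2' := normr_ge0 ((ln (D + 1) - ln c) / ln rho).
have {B1} h1 : y * ln C - ln c <= n%:R * ((x - y) * ln 2).
  by rewrite -ler_pdivrMr ?mulr_gt0 ?subr_gt0 //; move: Bn; rewrite /B; lra.
have {B2} h2 : ln (D + 1) - ln c <= n%:R * ln rho.
  by rewrite -ler_pdivrMr //; move: Bn; rewrite /B; lra.
have rho0 : 0 < rho by lra.
have b0 : 0 < (b r k)%:R :> R by rewrite ltr0n euler_binary_partition_gt0.
have lb : ln c + n%:R * ln rho <= ln (b r k)%:R.
  rewrite mulr_natl -lnXn // -lnM ?posrE ?exprn_gt0 // ler_ln ?posrE //.
  by rewrite mulr_gt0 ?exprn_gt0.
have Kk : (K <= k)%N.
  rewrite leqNgt; apply/negP => kK.
  have : ln (D + 1) <= ln (b r k)%:R by lra.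
  rewrite ler_ln ?posrE //; last by lra.
  rewrite /D (bigD1 (Ordinal kK)) //=.
  have : 0 <= \sum_(i < K | i != Ordinal kK) (b r i)%:R :> R by apply: sumr_ge0.
  lra.
have k2 : 1 < k%:R :> R by rewrite ltr1n (leq_trans _ Kk) // /K leq_maxr.
have k0 : 0 < k%:R :> R by lra.
have lk : ln k%:R <= ln C + n%:R * ln 2.
  rewrite mulr_natl -lnXn // -lnM ?posrE ?exprn_gt0 // ler_ln ?posrE //.
  by rewrite mulr_gt0 ?exprn_gt0.
exists k; first by rewrite (leq_trans _ Kk) // /K leq_maxl.
rewrite lee_fin /log_ratio ler_pdivlMr; last exact: ln_gt0.
have : y * ln k%:R <= y * (ln C + n%:R * ln 2) by rewrite ler_wpM2l.
move: lb; rewrite xE; lra.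
Qed.

End growth.

(** * The digit matrix and the mean growth rate *)

Section dyadic_growth.
Context {R : realType}.
Local Open Scope ring_scope.

(* Clearing denominators turns [1 - (2/r) A] into [r - 2 A], whose determinant
   is congruent to [r ^ N] modulo 2. *)
Lemma unitmx_sub_even N (A : 'M[int]_N) r : odd r ->
  1%:M - (2 / r%:R) *: map_mx intr A \in (unitmx : pred 'M[R]_N).
Proof.
move=> r_odd; have r0 : r%:R != 0 :> R by rewrite pnatr_eq0; case: r r_odd.
have -> : 1%:M - (2 / r%:R) *: map_mx intr A =
    r%:R^-1 *: map_mx intr (r%:Z%:M - 2 *: A) :> 'M[R]_N.
  rewrite rmorphB /= map_scalar_mx map_mxZ scalerBr scale_scalar_mx mulVf //.
  by rewrite scalerA mulrC.
rewrite unitmxZ ?unitfE ?invr_eq0 // unitmxE unitfE det_map_mx intr_eq0.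
have two0 : 2 = 0 :> 'F_2 by exact: val_inj.
have r1 : r%:R = 1 :> 'F_2.
  by rewrite -(odd_double_half r) r_odd -muln2 natrD natrM two0 mulr0 addr0.
have E : map_mx intr (r%:Z%:M - 2 *: A) = 1%:M :> 'M['F_2]_N.
  apply/matrixP => i j; rewrite !mxE rmorphB rmorphM rmorphMn /=.
  by rewrite -!pmulrn two0 mul0r subr0 r1.
apply/eqP => /(congr1 (fun z : int => z%:~R : 'F_2)) /eqP.
by rewrite -det_map_mx E det1 oner_eq0.
Qed.

Definition digit_mx r : 'M[int]_r.-1 := \matrix_(i, j) (i <= j.*2 < i + r)%N%:R.

(** The factor [2 / r] divides out the mean growth, so decay or growth of these iterates is measured
    against the mean. *)
Lemma iter_digit_mx r n (i : 'I_r.-1) :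
  iter n (mulmx ((2 / r%:R) *: map_mx intr (digit_mx r)))
    (\col_j (b r (r - j))%:R) i 0 =
  (2 / r%:R) ^+ n * (b r (r * 2 ^ n - i))%:R :> R.
Proof.
elim: n i => [|n IH] i; first by rewrite mxE expr0 mul1r muln1.
rewrite iterS mxE expnS mulnCA mul2n euler_binary_partition_sub ?ltn_ord //; last first.
  by rewrite leq_pmulr // expn_gt0.
rewrite natr_sum mulr_sumr; apply: eq_bigr => j _.
by rewrite IH !mxE natrM exprS; case: (_ <= _ < _)%N; rewrite /=; ring.
Qed.

Lemma ln_div_ln2_lt (x y : R) : 0 < x -> x < y -> ln x / ln 2 < ln y / ln 2.
Proof.
move=> x0 xy; rewrite ltr_pM2r ?invr_gt0 ?ln2_gt0 // ltr_ln // posrE.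
exact: lt_trans xy.
Qed.

Lemma p1_le_mean r : (2 <= r)%N -> (p1 R r <= (ln (r%:R / 2) / ln 2)%:E)%E.
Proof.
move=> r2; have r2R : 2 <= r%:R :> R by rewrite ler_nat.
have b0 : 0 < (b r 0)%:R :> R by rewrite ltr0n euler_binary_partition_gt0.
apply: (@p1_le R r (r%:R * (b r 0)%:R) 1) => //; [by rewrite mulr_gt0 //; lra|lra|].
move=> n; have [k [kn bk]] := exists_small_euler_binary_partition r n.
exists n, k; split=> //; first by rewrite mul1r -natrX ler_nat.
move: bk; rewrite -(ler_nat R) !natrM !natrX expr_div_n mulrA.
by rewrite ler_pdivlMr ?exprn_gt0 // mulrC exprS mulrAC.
Qed.

Lemma mean_le_p2 r : (3 <= r)%N -> ((ln (r%:R / 2) / ln 2)%:E <= p2 R r)%E.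
Proof.
move=> r3; have r3R : 3 <= r%:R :> R by rewrite ler_nat.
have b1 : 1 <= (b r 0)%:R :> R by rewrite ler1n euler_binary_partition_gt0 // ltnW.
apply: (@le_p2 R r r.+1%:R r.+1%:R^-1); [lia|by []|by rewrite invr_gt0|lra|].
move=> n; have [k [kn bk]] := exists_large_euler_binary_partition r n.
exists n, k; split=> //; first by rewrite -natrX -natrM ler_nat.
rewrite expr_div_n mulrA ler_pdivrMr ?exprn_gt0 // mulrC ler_pdivrMr //.
move: bk; rewrite -(ler_nat R) !natrM !natrX => bk.
rewrite mulrC mulrA mulrAC; apply: le_trans bk.
by rewrite ler_peMr // exprn_ge0.
Qed.

End dyadic_growth.

(** * Strict separation of the two exponents *)

Theorem theorem13 (R : realType) (r : nat) (r_odd : odd r)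
  (r_ge3 : (3 <= r)%N) : (p1 R r < p2 R r)%E.
Proof.
have r2 : (2 <= r)%N by exact: ltnW.
have r3R : (3 <= r%:R :> R)%R by rewrite ler_nat.
pose M : 'M[R]_r.-1 := ((2 / r%:R) *: map_mx intr (digit_mx r))%R.
pose w : 'cV[R]_r.-1 := (\col_j (b r (r - j))%:R)%R.
have M_ge0 i j : (0 <= M i j)%R by rewrite !mxE mulr_ge0 ?divr_ge0 // ler0z ler0n.
have w_ge1 i : (1 <= w i 0)%R by rewrite mxE ler1n euler_binary_partition_gt0.
have bE n i : ((b r (r * 2 ^ n - nat_of_ord i))%:R =
    (r%:R / 2) ^+ n * iter n (mulmx M) w i 0 :> R)%R.
  rewrite iter_digit_mx mulrA -exprMn (_ : r%:R / 2 * (2 / r%:R) = 1)%R; last first.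
    by field; lra.
  by rewrite expr1n mul1r.
have [] := nonneg_iter_dichotomy M_ge0 (unitmx_sub_even (digit_mx r) r_odd) w_ge1.
  move=> [i [c [rho [c0 rho1 [n0 H]]]]].
  apply: le_lt_trans (p1_le_mean r2) _.
  apply: (@lt_le_trans _ _ (ln (r%:R / 2 * rho) / ln 2)%:E)%R.
    by rewrite lte_fin ln_div_ln2_lt //; nra.
  apply: (@le_p2 R r r%:R c) => //; [lra|nra|] => m.
  exists (maxn n0 m), (r * 2 ^ maxn n0 m - i)%N; split.
  - exact: leq_maxr.
  - by rewrite -natrX -natrM ler_nat leq_subr.
  rewrite bE exprMn mulrCA ler_wpM2l ?exprn_ge0 ?divr_ge0 //.
  by apply: H; exact: leq_maxl.
move=> [C [rho [C0 /andP[rho0 rho1] H]]].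
apply: lt_le_trans _ (mean_le_p2 r_ge3).
(* [p1_le] needs a rate of at least 1, which [r / 2 * rho] may miss; as [r / 2 > 1], the maximum is
   still below [r / 2]. *)
apply: (@le_lt_trans _ _ (ln (Num.max 1 (r%:R / 2 * rho)) / ln 2)%:E)%R; last first.
  rewrite lte_fin ln_div_ln2_lt // ?lt_max ?ltr01 // gt_max; apply/andP; split; nra.
(* Decay holds in every coordinate; coordinate 0 gives [k = r * 2 ^ n]. *)
have i0 : (0 < r.-1)%N by lia.
apply: (@p1_le R r C 1%R) => //; first by rewrite le_max lexx.
move=> n; exists n, (r * 2 ^ n - Ordinal i0)%N; split=> //.
  by rewrite subn0 mul1r -natrX ler_nat leq_pmull //; lia.
rewrite bE; apply: le_trans (_ : (r%:R / 2) ^+ n * (C * rho ^+ n) <= _)%R.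
  by rewrite ler_wpM2l ?exprn_ge0 ?divr_ge0.
rewrite mulrCA -exprMn ler_wpM2l ?(ltW C0) // lerXn2r ?nnegrE //.
- by rewrite mulr_ge0 ?divr_ge0 // ltW.
- by rewrite le_max ler01.
- by rewrite le_max lexx orbT.
Qed.
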